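(* $\mathsf{WSCAC} \not\leq_{\mathrm{c}} \mathsf{SCAC}$; that is, the chain/antichain principle for weakly stable partial orders is not computably reducible to the chain/antichain principle for stable partial orders.
   Context: All sets are subsets of $\omega$ and all partial orders have field $\omega$. A problem is given by a class of instances (subsets of $\omega$, up to coding) and, for each instance, a class of solutions. For problems $\mathsf{P},\mathsf{Q}$, $\mathsf{P}$ is computably reducible to $\mathsf{Q}$, written $\mathsf{P}\leq_{\mathrm{c}}\mathsf{Q}$, if every instance $X$ of $\mathsf{P}$ computes an instance $\widehat{X}$ of $\mathsf{Q}$ such that if $\widehat{Y}$ is any solution to $\widehat{X}$ then there is a solution $Y$ to $X$ computable from $X\oplus\widehat{Y}$. Let $\leq_P$ be a partial order on $\omega$. Write $x \mid_P y$ if $x,y$ are $\leq_P$-incomparable. An element $x$ is small if $x\leq_P y$ for almost every (all but finitely many) $y$; large if $y\leq_P x$ for almost every $y$; isolated if $x\mid_P y$ for almost every $y$. The order $\leq_P$ is stable if either every $x$ is small or isolated, or else every $x$ is large or isolated. It is weakly stable if every $x$ is small, isolated, or large. A chain is a set of pairwise comparable elements; an antichain is a set of pairwise incomparable (distinct) elements. $\mathsf{SCAC}$: every stable partial order has an infinite chain or antichain. $\mathsf{WSCAC}$: every weakly stable partial order has an infinite chain or antichain. In each case the instances are the orders of the indicated kind and the solutions are the infinite chains and infinite antichains of the order. *)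

(* Defs.v *)
From Stdlib Require Cantor Relation_Definitions.
From mathcomp Require Import all_boot.
From mathcomp Require Import boolp classical_sets cardinality.

Set Implicit Arguments.
Unset Strict Implicit.
Unset Printing Implicit Defensive.

Local Open Scope classical_set_scope.

Definition cpair (x y : nat) : nat := Cantor.to_nat (x, y).

Definition char_fun (A : set nat) (n : nat) : nat := `[< A n >].

(** Codes for Kleene's partial recursive functions with an oracle, presented as
    unary functions on [nat]: several arguments are packed with the Cantor
    pairing bijection. *)
Inductive code : Type :=
| Zero | Succ | Fst | Snd | Oracle
| Pair of code & code
| Comp of code & code
| Prec of code & code
| Mu of code.

(** [eval A c x v]: the partial function with code [c] and oracle [A] converges
    on [x] with value [v].  In [eval_mu], minimization is over the [n] at which
    [c] vanishes, all earlier values being defined and nonzero; [g] lists the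
    predecessors of these earlier values. *)
Inductive eval (A : set nat) : code -> nat -> nat -> Prop :=
| eval_zero x : eval A Zero x 0
| eval_succ x : eval A Succ x x.+1
| eval_fst x y : eval A Fst (cpair x y) x
| eval_snd x y : eval A Snd (cpair x y) y
| eval_oracle x : eval A Oracle x (char_fun A x)
| eval_pair c d x u v :
    eval A c x u -> eval A d x v -> eval A (Pair c d) x (cpair u v)
| eval_comp c d x u v :
    eval A d x u -> eval A c u v -> eval A (Comp c d) x v
| eval_prec0 c d x v :
    eval A c x v -> eval A (Prec c d) (cpair x 0) v
| eval_precS c d x n u v :
    eval A (Prec c d) (cpair x n) u -> eval A d (cpair x (cpair n u)) v ->
    eval A (Prec c d) (cpair x n.+1) v
| eval_mu c x n (g : nat -> nat) :
    (forall m, m < n -> eval A c (cpair x m) (g m).+1) ->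
    eval A c (cpair x n) 0 -> eval A (Mu c) x n.

Definition turing_le (B A : set nat) : Prop :=
  exists c, forall x, eval A c x (char_fun B x).

Definition set_join (A B : set nat) : set nat :=
  [set n.*2 | n in A] `|` [set n.*2.+1 | n in B].

Record problem : Type := Problem {
  instance : set (set nat);
  solution : set nat -> set (set nat) (* meaningful on instances only *)
}.

Definition computably_reducible (P Q : problem) : Prop :=
  forall X, instance P X ->
    exists X', [/\ turing_le X' X, instance Q X' &
      forall Y', solution Q X' Y' ->
        exists2 Y, solution P X Y & turing_le Y (set_join X Y')].

Section PartialOrders.
Variable le : nat -> nat -> Prop.

Definition partial_order : Prop := Relation_Definitions.order nat le.

Definition incomparable (x y : nat) : Prop := ~ le x y /\ ~ le y x.

Definition small (x : nat) : Prop := cofinite_set [set y | le x y].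
Definition large (x : nat) : Prop := cofinite_set [set y | le y x].
Definition isolated (x : nat) : Prop := cofinite_set [set y | incomparable x y].

Definition stable : Prop :=
  (forall x, small x \/ isolated x) \/ (forall x, large x \/ isolated x).

Definition weakly_stable : Prop :=
  forall x, [\/ small x, isolated x | large x].

Definition chain (S : set nat) : Prop := total_on S le.

Definition antichain (S : set nat) : Prop :=
  forall x y, S x -> S y -> x <> y -> incomparable x y.

End PartialOrders.

Definition rel_of (X : set nat) (x y : nat) : Prop := X (cpair x y).

Definition infinite_chain_or_antichain (X : set nat) : set (set nat) :=
  [set S | infinite_set S /\ (chain (rel_of X) S \/ antichain (rel_of X) S)].

Definition SCAC : problem := {|
  instance := [set X | partial_order (rel_of X) /\ stable (rel_of X)];
  solution := infinite_chain_or_antichain |}.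

Definition WSCAC : problem := {|
  instance := [set X | partial_order (rel_of X) /\ weakly_stable (rel_of X)];
  solution := infinite_chain_or_antichain |}.

(* Main.v *)
Require Import Defs.
From HB Require Import structures.
From mathcomp Require Import all_boot zify.
From mathcomp Require Import boolp classical_sets cardinality.

Set Implicit Arguments.
Unset Strict Implicit.
Unset Printing Implicit Defensive.

Local Open Scope classical_set_scope.

(** Suppose that the reduction exists.  Each weakly stable order [X] then computes,
    by some code [c], a stable order [X'] each of whose solutions computes, together
    with [X], a solution to [X].  Up to reversing it, all elements of [X'] are small
    or isolated: an infinite chain of [X'] consists of small elements, an infinite
    antichain of isolated ones, and both can be built by finite extensions.  A
    solution built generically this way computes no solution to [X], unless some
    code [d] and some finite approximation are such that all outputs of [d] along
    all further approximations are forever correct: none of them is isolated in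
    [X] when [d] computes a chain, all of them are when [d] computes an antichain
    ([generic_homogeneous]).  So such a pair exists for the chains of [X'] and
    another one for its antichains (or one kind of element is almost absent from
    [X'], which is simpler).

    These data range over a countable set, while the weakly stable orders form a
    Baire space for the topology given by finite conditions which may promise
    that an element is small, isolated or large.  Hence the same data work for a
    set of orders that is dense below some condition ([somewhere_dense]).  This is
    absurd ([double_reason_nowhere_dense]).  In one such order, take a finite chain
    of small elements of [X'] that outputs some [v], and then a finite antichain
    of isolated elements above that chain that outputs some much later [v'].  All
    this depends on a finite part of the order only, which does not determine the
    final behaviour of [v] and [v'].  Extend it so that both outputs become wrong.
    The chain now must contain an isolated element of [X'], for otherwise its
    output would be correct; then the elements above it are isolated too, so the
    antichain remains a legitimate approximation and its output is correct after
    all.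

    Making two outputs wrong at once is where three kinds of elements are needed
    ([spoil_two]): with small and isolated elements only, the order could serve as
    its own stable instance. *)

(** * Pairing, cofinite and infinite sets of numbers *)

Definition unpair (z : nat) : nat * nat := Cantor.of_nat z.

Lemma cpairK x y : unpair (cpair x y) = (x, y).
Proof. exact: Cantor.cancel_of_to. Qed.

Lemma unpairK z : cpair (unpair z).1 (unpair z).2 = z.
Proof. by rewrite /cpair -surjective_pairing; exact: Cantor.cancel_to_of. Qed.

Lemma cpair_inj x y x' y' : cpair x y = cpair x' y' -> x = x' /\ y = y'.
Proof. by move=> /(congr1 unpair); rewrite !cpairK => -[]. Qed.

Lemma leq_cpair x y : x <= cpair x y /\ y <= cpair x y.
Proof. by have := Cantor.to_nat_non_decreasing x y; rewrite /cpair; lia. Qed.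

Definition set_of_rel (R : nat -> nat -> Prop) : set nat :=
  [set z | R (unpair z).1 (unpair z).2].

Lemma rel_of_set_of_rel R x y : rel_of (set_of_rel R) x y = R x y.
Proof. by rewrite /rel_of /set_of_rel /= cpairK. Qed.

Lemma infinite_setNP (A : set nat) :
  infinite_set A <-> forall n, exists2 x, n <= x & A x.
Proof.
split=> [infA n|unbA].
  apply: contrapT => bndA; apply: infA; apply: sub_finite_set (finite_II n).
  move=> x Ax /=; rewrite ltnNge; apply/negP => le_nx.
  by apply: bndA; exists x.
case/finite_seqP => s eqA.
have [x lt_sx] := unbA (\max_(i <- s) i).+1; rewrite eqA /= => s_x.
by have := @leq_bigmax_seq _ s xpredT (fun i => i) x s_x isT; rewrite leqNgt lt_sx.
Qed.

Lemma cofinite_setNP (A : set nat) :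
  cofinite_set A <-> exists n, forall x, n <= x -> A x.
Proof.
split=> [cofA|[n geA]].
  apply: contrapT => /forallNP noA.
  suff : infinite_set (~` A) by apply.
  apply/infinite_setNP => n.
  by have /existsNP[x /not_implyP[]] := noA n; exists x.
apply: sub_finite_set (finite_II n) => x nAx /=.
by rewrite ltnNge; apply/negP => /geA.
Qed.

(** * Oracle computations *)

(* Inversion on an evaluation whose argument is a pair leaves equations
   between codes of pairs. *)
Ltac inv_eval ev :=
  match type of ev with eval _ _ ?z _ =>
    let z' := fresh in let eqz := fresh in
    remember z as z' eqn:eqz; inversion ev; subst
  end;
  repeat match goal with
  | eq : cpair _ _ = cpair _ _ |- _ =>
      let eq1 := fresh in let eq2 := fresh in
      case: (cpair_inj eq) => eq1 eq2; clear eq; subst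
  end.

Lemma eval_fun A c x u v : eval A c x u -> eval A c x v -> u = v.
Proof.
move=> ev; elim: ev v => {c x u}.
- by move=> x v ev; inv_eval ev.
- by move=> x v ev; inv_eval ev.
- by move=> x y v ev; inv_eval ev.
- by move=> x y v ev; inv_eval ev.
- by move=> x v ev; inv_eval ev.
- move=> c d x u v _ IHu _ IHv w ev; inv_eval ev.
  by congr cpair; [apply: IHu|apply: IHv].
- move=> c d x u v _ IHu _ IHv w ev; inv_eval ev.
  by apply: IHv; rewrite (IHu _ ltac:(eassumption)).
- by move=> c d x v _ IHv w ev; inv_eval ev; apply: IHv.
- move=> c d x n u v _ IHu _ IHv w ev; inv_eval ev => //.
  match goal with eq : _.+1 = _.+1 |- _ => case: eq => eqn; subst end.
  by apply: IHv; rewrite (IHu _ ltac:(eassumption)).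
- move=> c x n g _ IHg _ IH0 w ev.
  inversion ev as [| | | | | | | | |? ? ? g' evg ev0]; subst.
  by case: (ltngtP n w) => // [/evg/IH0|/IHg IH]; last by have := IH _ ev0.
Qed.

(** Two sets agreeing below [n] lie in the same basic clopen set. *)
Definition agree (n : nat) (A B : set nat) := forall i, i < n -> (A i <-> B i).

Lemma agree_leq m n A B : m <= n -> agree n A B -> agree m A B.
Proof. by move=> le_mn AB i lt_im; apply: AB; apply: leq_trans le_mn. Qed.

(** [Phi] is a neighbourhood of [A] in Cantor space. *)
Definition nbhd (A : set nat) (Phi : set nat -> Prop) :=
  exists n, forall B, agree n A B -> Phi B.

Lemma nbhd_point A Phi : nbhd A Phi -> Phi A.
Proof. by case=> n; apply. Qed.

Lemma nbhd_sub A (Phi Psi : set nat -> Prop) :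
  (forall B, Phi B -> Psi B) -> nbhd A Phi -> nbhd A Psi.
Proof. by move=> sub [n PhiA]; exists n => B /PhiA/sub. Qed.

Lemma nbhd_all A (Phi : set nat -> Prop) : (forall B, Phi B) -> nbhd A Phi.
Proof. by exists 0. Qed.

Lemma nbhd_and A (Phi Psi : set nat -> Prop) :
  nbhd A Phi -> nbhd A Psi -> nbhd A (fun B => Phi B /\ Psi B).
Proof.
move=> [n PhiA] [m PsiA]; exists (maxn n m) => B AB.
by split; [apply: PhiA|apply: PsiA]; apply: agree_leq AB;
   rewrite ?leq_maxl ?leq_maxr.
Qed.

Lemma nbhd_forall_lt A (Phi : nat -> set nat -> Prop) n :
  (forall m, m < n -> nbhd A (Phi m)) ->
  nbhd A (fun B => forall m, m < n -> Phi m B).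
Proof.
elim: n => [|n IHn] PhiA; first exact: nbhd_all.
apply: nbhd_sub (nbhd_and (IHn _) (PhiA n _)) => //.
  move=> B [PhiB PhinB] m; rewrite ltnS leq_eqVlt.
  by case/predU1P=> [->|/PhiB].
by move=> m lt_mn; apply: PhiA; apply: ltnW.
Qed.

Lemma nbhd_open A Phi : nbhd A Phi -> nbhd A (fun B => nbhd B Phi).
Proof.
move=> [n PhiA]; exists n => B AB; exists n => C BC; apply: PhiA => i lt_in.
by apply: iff_trans (AB _ lt_in) (BC _ lt_in).
Qed.

(** A convergent computation queries its oracle finitely often. *)
Lemma eval_use A c x v : eval A c x v -> nbhd A (fun B => eval B c x v).
Proof.
elim=> {c x v}; try by move=> *; apply: nbhd_all => B; constructor.
- move=> x; exists x.+1 => B AB.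
  have -> : char_fun A x = char_fun B x.
    by congr nat_of_bool; apply/asbool_equiv_eq/AB.
  exact: eval_oracle.
- move=> c d x u v _ IHu _ IHv; apply: nbhd_sub (nbhd_and IHu IHv) => B [].
  exact: eval_pair.
- move=> c d x u v _ IHu _ IHv; apply: nbhd_sub (nbhd_and IHu IHv) => B [].
  exact: eval_comp.
- by move=> c d x v _; apply: nbhd_sub => B; apply: eval_prec0.
- move=> c d x n u v _ IHu _ IHv; apply: nbhd_sub (nbhd_and IHu IHv) => B [].
  exact: eval_precS.
- move=> c x n g _ /nbhd_forall_lt IHg _ IH0.
  by apply: nbhd_sub (nbhd_and IHg IH0) => B []; apply: eval_mu.
Qed.

Lemma agree_set_join n X Y A B :
  agree n X Y -> agree n A B -> agree n (set_join X A) (set_join Y B).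
Proof.
move=> XY AB i lt_in; split=> -[] [m mP eqi];
  rewrite -{}eqi in lt_in *; [left|right|left|right];
  exists m => //; [apply/XY|apply/AB|apply/XY|apply/AB] => //; lia.
Qed.

Definition computes (c : code) (X X' : set nat) :=
  forall z, eval X c z (char_fun X' z).

Lemma computes_eval1 c X X' z : computes c X X' -> eval X c z 1 <-> X' z.
Proof.
move=> cX'; split=> [/eval_fun/(_ (cX' z))|X'z].
  by rewrite /char_fun; case: asboolP.
by have := cX' z; rewrite /char_fun asboolT.
Qed.

(** On boundedly many arguments, a uniformly computed binary relation is a
    continuous function of the oracle. *)
Lemma nbhd_computes c X X' b : computes c X X' ->
  nbhd X (fun Y => forall x, x < b -> forall y, y < b ->
    forall Y', computes c Y Y' -> (rel_of X' x y <-> rel_of Y' x y)).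
Proof.
move=> cX'; apply: nbhd_forall_lt => x _; apply: nbhd_forall_lt => y _.
apply: nbhd_sub (eval_use (cX' (cpair x y))) => Y evY Y' cY'.
have := eval_fun evY (cY' (cpair x y)); rewrite /char_fun /rel_of.
by case: asboolP; case: asboolP.
Qed.

(** * Codes are countable *)

Fixpoint tree_of_code (c : code) : GenTree.tree nat :=
  match c with
  | Zero => GenTree.Leaf 0
  | Succ => GenTree.Leaf 1
  | Fst => GenTree.Leaf 2
  | Snd => GenTree.Leaf 3
  | Oracle => GenTree.Leaf 4
  | Pair c d => GenTree.Node 0 [:: tree_of_code c; tree_of_code d]
  | Comp c d => GenTree.Node 1 [:: tree_of_code c; tree_of_code d]
  | Prec c d => GenTree.Node 2 [:: tree_of_code c; tree_of_code d]
  | Mu c => GenTree.Node 3 [:: tree_of_code c]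
  end.

Fixpoint code_of_tree (t : GenTree.tree nat) : code :=
  match t with
  | GenTree.Leaf 0 => Zero
  | GenTree.Leaf 1 => Succ
  | GenTree.Leaf 2 => Fst
  | GenTree.Leaf 3 => Snd
  | GenTree.Node 0 [:: t; u] => Pair (code_of_tree t) (code_of_tree u)
  | GenTree.Node 1 [:: t; u] => Comp (code_of_tree t) (code_of_tree u)
  | GenTree.Node 2 [:: t; u] => Prec (code_of_tree t) (code_of_tree u)
  | GenTree.Node 3 [:: t] => Mu (code_of_tree t)
  | _ => Oracle
  end.

Lemma tree_of_codeK : cancel tree_of_code code_of_tree.
Proof. by elim=> //= [c -> d ->|c -> d ->|c -> d ->|c ->]. Qed.

HB.instance Definition _ := Countable.copy code (can_type tree_of_codeK).

(** * Limit behaviour of weakly stable orders *)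

Inductive label := LS | LI | LL.

(** The relation that an element labelled small, isolated or large bears to
    all sufficiently late elements. *)
Definition lab_rel (le : nat -> nat -> Prop) (l : label) (x y : nat) : Prop :=
  match l with
  | LS => le x y
  | LI => incomparable le x y
  | LL => le y x
  end.

Lemma eq_lab_rel (le le' : nat -> nat -> Prop) l x y :
  (le x y <-> le' x y) -> (le y x <-> le' y x) ->
  lab_rel le l x y -> lab_rel le' l x y.
Proof.
by move=> [xy1 xy2] [yx1 yx2]; case: l; rewrite /lab_rel /incomparable; tauto.
Qed.

Lemma smallP le x : small le x <-> exists n, forall y, n <= y -> le x y.
Proof. exact: cofinite_setNP. Qed.

Lemma isolatedP le x :
  isolated le x <-> exists n, forall y, n <= y -> incomparable le x y.
Proof. exact: cofinite_setNP. Qed.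

Lemma largeP le x : large le x <-> exists n, forall y, n <= y -> le y x.
Proof. exact: cofinite_setNP. Qed.

Lemma weakly_stable_label le x : weakly_stable le ->
  exists l n, forall y, n <= y -> lab_rel le l x y.
Proof.
move=> /(_ x) []; [move=> /smallP|move=> /isolatedP|move=> /largeP] => -[n nP].
- by exists LS, n.
- by exists LI, n.
- by exists LL, n.
Qed.

Lemma label_weakly_stable le :
  (forall x, exists l n, forall y, n <= y -> lab_rel le l x y) ->
  weakly_stable le.
Proof.
move=> labs x; have [[] [n nP]] := labs x.
- by apply: Or31; apply/smallP; exists n.
- by apply: Or32; apply/isolatedP; exists n.
- by apply: Or33; apply/largeP; exists n.
Qed.

Lemma isolated_label le l x n : (forall y, n <= y -> lab_rel le l x y) ->
  isolated le x <-> l = LI.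
Proof.
move=> nP; split=> [/isolatedP[m mP]|eql]; last first.
  by apply/isolatedP; exists n => y /nP; rewrite eql.
have := nP (maxn m n) (leq_maxr _ _); have := mP (maxn m n) (leq_maxl _ _).
by rewrite /incomparable; case: l {nP} => //=; tauto.
Qed.

(** The elements that may occur in an infinite antichain ([ty = true]) or in an
    infinite chain ([ty = false]) of a weakly stable order. *)
Definition admissible (le : nat -> nat -> Prop) (ty : bool) (x : nat) : Prop :=
  isolated le x <-> ty.

Lemma chain_admissible le S x : chain le S -> infinite_set S -> S x ->
  admissible le false x.
Proof.
move=> chS /infinite_setNP infS Sx; split=> // /isolatedP[n nP].
have [y /nP[nxy nyx] Sy] := infS n.
by case: (chS _ _ Sx Sy).
Qed.

Lemma antichain_admissible le S x : weakly_stable le ->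
  antichain le S -> infinite_set S -> S x -> admissible le true x.
Proof.
move=> ws acS /infinite_setNP infS Sx; split=> // _.
have [l [n nP]] := weakly_stable_label x ws.
apply/(isolated_label nP).
have [y le_y Sy] := infS (maxn n x.+1).
have /acS : S x by [].
move=> /(_ _ Sy)[|nxy nyx]; first by move=> eqxy; move: le_y; rewrite eqxy; lia.
have := nP y (leq_trans (leq_maxl _ _) le_y).
by case: l {nP} => //=.
Qed.

(** * Conditions *)

(** A condition fixes the order [ord] below [len] and promises that each of
    these finitely many elements relates to all later ones as its label says.
    The total set [ord] is one completion of the condition; its part beyond
    [len] carries no information. *)
Record cond := Cond { ord : set nat; lab : nat -> label; len : nat }.

Definition in_cond (X : set nat) (p : cond) : Prop :=
  (forall x y, x < len p -> y < len p ->
    (rel_of X x y <-> rel_of (ord p) x y)) /\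
  (forall x y, x < len p -> len p <= y -> lab_rel (rel_of X) (lab p x) x y).

Definition valid (p : cond) : Prop :=
  partial_order (rel_of (ord p)) /\ in_cond (ord p) p.

Definition extends (q p : cond) : Prop :=
  [/\ in_cond (ord q) p, len p <= len q &
      forall x, x < len p -> lab q x = lab p x].

Lemma in_cond_extends X p q : extends q p -> in_cond X q -> in_cond X p.
Proof.
move=> [[qp_ord qp_lab] le_pq eq_lab] [Xq_ord Xq_lab].
split=> [x y ltx lty|x y ltx ley].
  apply: iff_trans (qp_ord _ _ ltx lty); apply: Xq_ord; exact: leq_trans le_pq.
have ltxq : x < len q by apply: leq_trans le_pq.
case: (ltnP y (len q)) => [lty|/(Xq_lab _ _ ltxq)]; last by rewrite eq_lab.
by apply: eq_lab_rel (qp_lab _ _ ltx ley); apply: iff_sym; apply: Xq_ord.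
Qed.

Lemma extends_refl p : valid p -> extends p p.
Proof. by case=> _ pp; split. Qed.

Lemma extends_trans p q r : extends r q -> extends q p -> extends r p.
Proof.
move=> rq qp; have [rq_in le_qr rq_lab] := rq; have [qp_in le_pq qp_lab] := qp.
split; [exact: in_cond_extends rq_in|exact: leq_trans le_qr|move=> x ltx].
by rewrite rq_lab ?qp_lab //; apply: leq_trans le_pq.
Qed.

Lemma in_cond_isolated X p x : in_cond X p -> x < len p ->
  isolated (rel_of X) x <-> lab p x = LI.
Proof. by move=> [_ Xp] ltx; apply: isolated_label => y; apply: Xp. Qed.

Section Relabel.
Variables (p : cond) (X : set nat) (N : nat) (D U : set nat).
Hypothesis poX : partial_order (rel_of X).
Hypothesis Xp : in_cond X p.
Hypothesis le_pN : len p <= N.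
Hypothesis D_down : forall x y, len p <= x -> D y -> rel_of X x y -> D x.
Hypothesis U_up : forall x y, len p <= y -> U x -> rel_of X x y -> U y.
Hypothesis DU_le : forall x y, D x -> U y -> rel_of X x y.
Hypothesis DU_disj : forall x, D x -> U x -> False.

Definition relab (x : nat) : label :=
  if x < len p then lab p x
  else if `[< D x >] then LS else if `[< U x >] then LL else LI.

Definition relab_le (x y : nat) : Prop :=
  if x < N then if y < N then rel_of X x y else relab x = LS
  else if y < N then relab y = LL else x = y.

Let X_refl x : rel_of X x x. Proof. by case: poX. Qed.
Let X_anti x y : rel_of X x y -> rel_of X y x -> x = y.
Proof. by case: poX => _ _; apply. Qed.
Let X_trans x y z : rel_of X x y -> rel_of X y z -> rel_of X x z.
Proof. by case: poX => _ tr _; apply: tr. Qed.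

Let relabP x : (x < len p /\ relab x = lab p x) \/
  len p <= x /\ [\/ D x /\ relab x = LS, U x /\ relab x = LL | relab x = LI].
Proof.
rewrite /relab; case: ltnP => lex; [by left|right; split=> //].
by case: asboolP => [Dx|_]; [|case: asboolP => Ux];
  [apply: Or31|apply: Or32|apply: Or33].
Qed.

Let old_lab x y : x < len p -> len p <= y -> lab_rel (rel_of X) (lab p x) x y.
Proof. by case: Xp => _; apply. Qed.

Let neq_old x y : x < len p -> len p <= y -> x <> y.
Proof. by move=> ltx ley eqxy; move: ltx; rewrite eqxy ltnNge ley. Qed.

Lemma relab_old x : x < len p -> relab x = lab p x.
Proof. by rewrite /relab => ->. Qed.

Lemma relab_D x : len p <= x -> D x -> relab x = LS.
Proof. by move=> lex Dx; rewrite /relab ltnNge lex /= asboolT. Qed.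

Lemma relab_U x : len p <= x -> U x -> relab x = LL.
Proof.
move=> lex Ux; rewrite /relab ltnNge lex /= asboolF ?asboolT // => Dx.
exact: DU_disj Ux.
Qed.

Lemma relab_I x : len p <= x -> ~ D x -> ~ U x -> relab x = LI.
Proof. by move=> lex nD nU; rewrite /relab ltnNge lex /= !asboolF. Qed.

(* The new labels satisfy the three closure properties that make the late
   elements fit in consistently: small elements are closed downwards, large ones
   upwards, and each small element is below each large one. *)
Let small_down x y : relab y = LS -> rel_of X x y -> relab x = LS.
Proof.
move=> laby xy.
have [[lty eqy]|[ley [[Dy _]|[_]|]]] := relabP y; try by rewrite laby.
  have [[ltx eqx]|[lex _]] := relabP x; last first.
    have := old_lab lty lex; rewrite -eqy laby /= => yx.
    by case: (neq_old lty lex); apply: X_anti.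
  have := old_lab lty (leqnn _); rewrite -eqy laby /= => yp.
  have := old_lab ltx (leqnn _); rewrite -eqx; case: (relab x) => //= [[nxp _]|px].
    by case: nxp; apply: X_trans yp.
  by case: (neq_old lty (leqnn _)); apply: X_anti yp _; apply: X_trans px _.
have [[ltx ->]|[lex _]] := relabP x; last by apply: relab_D => //; apply: D_down xy.
have := old_lab ltx ley; case: (lab p x) => //= [[]//|yx].
by case: (neq_old ltx ley); apply: X_anti.
Qed.

Let large_up x y : relab x = LL -> rel_of X x y -> relab y = LL.
Proof.
move=> labx xy.
have [[ltx eqx]|[lex [[_]|[Ux _]|]]] := relabP x; try by rewrite labx.
  have [[lty eqy]|[ley _]] := relabP y; last first.
    have := old_lab ltx ley; rewrite -eqx labx /= => yx.
    by case: (neq_old ltx ley); apply: X_anti.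
  have := old_lab ltx (leqnn _); rewrite -eqx labx /= => px.
  have := old_lab lty (leqnn _); rewrite -eqy; case: (relab y) => //= [yp|[_ npy]].
    by case: (neq_old ltx (leqnn _)); apply: X_anti px; apply: X_trans xy _.
  by case: npy; apply: X_trans px _.
have [[lty ->]|[ley _]] := relabP y; last by apply: relab_U => //; apply: U_up xy.
have := old_lab lty lex; case: (lab p y) => //= [yx|[]//].
by case: (neq_old lty lex); apply: X_anti.
Qed.

Let small_le_large x y : relab x = LS -> relab y = LL -> rel_of X x y.
Proof.
move=> labx laby.
have [[ltx eqx]|[lex [[Dx _]|[_]|]]] := relabP x; try by rewrite labx.
  have [[lty eqy]|[ley _]] := relabP y; last first.
    by have := old_lab ltx ley; rewrite -eqx labx.
  apply: (@X_trans _ (len p)).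
    by have := old_lab ltx (leqnn _); rewrite -eqx labx.
  by have := old_lab lty (leqnn _); rewrite -eqy laby.
have [[lty eqy]|[ley [[_]|[Uy _]|]]] := relabP y; try by rewrite laby.
  by have := old_lab lty lex; rewrite -eqy laby.
exact: DU_le.
Qed.

Lemma relab_le_order : partial_order relab_le.
Proof.
split=> [x|x y z|x y]; rewrite /relab_le.
- by case: ltnP.
- case: ltnP => ltx; case: ltnP => lty; case: ltnP => ltz //.
  + exact: X_trans.
  + by move=> xy /small_down; apply.
  + exact: small_le_large.
  + exact: large_up.
  + by move=> ->.
  + by move=> ->.
- case: ltnP => ltx; case: ltnP => lty //.
  + exact: X_anti.
  + by move=> ->.
  + by move=> ->.
Qed.

Definition relab_cond : cond := Cond (set_of_rel relab_le) relab N.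

Lemma relab_cond_old x y : x < N -> y < N ->
  rel_of (ord relab_cond) x y <-> rel_of X x y.
Proof. by move=> ltx lty; rewrite rel_of_set_of_rel /relab_le ltx lty. Qed.

Lemma relab_cond_new x y : x < N -> N <= y ->
  lab_rel (rel_of (ord relab_cond)) (relab x) x y.
Proof.
move=> ltx ley; case labx: (relab x); rewrite /= /incomparable !rel_of_set_of_rel;
  by rewrite /relab_le ltx ltnNge ley /= labx.
Qed.

Lemma relab_cond_valid : valid relab_cond.
Proof.
split; last by split=> //; exact: relab_cond_new.
rewrite /=; have -> : rel_of (set_of_rel relab_le) = relab_le.
  by apply/funext => x; apply/funext => y; rewrite rel_of_set_of_rel.
exact: relab_le_order.
Qed.

Lemma relab_cond_extends : extends relab_cond p.
Proof.
split=> //=; last exact: relab_old.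
split=> [x y ltx lty|x y ltx ley].
  have ltN z : z < len p -> z < N by move=> /leq_trans; apply.
  by rewrite (relab_cond_old (ltN _ ltx) (ltN _ lty)); case: Xp => + _; apply.
have ltxN := leq_trans ltx le_pN.
case: (ltnP y N) => [ltyN|leyN]; last by rewrite -relab_old //; apply: relab_cond_new.
by apply: eq_lab_rel (old_lab ltx ley); apply: iff_sym; exact: relab_cond_old.
Qed.

End Relabel.

(** Labels that are not yet promised can be revised, without any effect on the
    computations seen so far if these use the order below [N] only. *)
Lemma relabel p X N (D U : set nat) :
  partial_order (rel_of X) -> in_cond X p -> len p <= N ->
  (forall x y, len p <= x -> D y -> rel_of X x y -> D x) ->
  (forall x y, len p <= y -> U x -> rel_of X x y -> U y) ->
  (forall x y, D x -> U y -> rel_of X x y) ->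
  (forall x, D x -> U x -> False) ->
  exists q, [/\ valid q, extends q p, len q = N &
    forall Z, in_cond Z q -> agree N X Z /\
      forall x, len p <= x -> x < N ->
        (isolated (rel_of Z) x <-> ~ D x /\ ~ U x)].
Proof.
move=> poX Xp le_pN Dd Uu DU_le DU_disj; exists (relab_cond p X N D U).
split=> //; [exact: relab_cond_valid|exact: relab_cond_extends|].
move=> Z Zq; split=> [z lt_zN|x lex lt_xN].
  have [le1 le2] := leq_cpair (unpair z).1 (unpair z).2.
  rewrite unpairK in le1 le2; rewrite -(unpairK z).
  have lt1 := leq_ltn_trans le1 lt_zN; have lt2 := leq_ltn_trans le2 lt_zN.
  have [Zq_ord _] := Zq.
  apply: iff_sym; apply: iff_trans (Zq_ord _ _ lt1 lt2) _.
  exact: relab_cond_old.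
apply: iff_trans (in_cond_isolated Zq lt_xN) _ => /=; split.
  by move=> labx; split=> [/(relab_D U lex)|/(relab_U DU_disj lex)]; rewrite labx.
by case; apply: relab_I.
Qed.

Lemma lengthen p N : valid p ->
  exists q, [/\ valid q, extends q p & N <= len q].
Proof.
case=> pop pp.
have le_pN : len p <= maxn N (len p) by rewrite leq_maxr.
have [//|//|//|//|q [vq qp lenq _]] := @relabel p (ord p) _ set0 set0 pop pp le_pN.
by exists q; split=> //; rewrite lenq leq_maxl.
Qed.

Lemma spoil_one p X v N ty :
  partial_order (rel_of X) -> in_cond X p -> len p <= v -> v < N ->
  exists q, [/\ valid q, extends q p &
    forall Z, in_cond Z q -> agree N X Z /\ ~ admissible (rel_of Z) ty v].
Proof.
move=> poX Xp lev ltvN; have [X_refl X_trans _] := poX.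
pose D := [set x | ty /\ rel_of X x v].
have Dd x y : len p <= x -> D y -> rel_of X x y -> D x.
  by move=> _ [? yv] xy; split=> //; apply: X_trans yv.
have le_pN := leq_trans lev (ltnW ltvN).
have [//|//|//|q [vq qp _ Zq]] := @relabel p X N D set0 poX Xp le_pN Dd.
exists q; split=> // Z /Zq[XZ isoZ]; split=> //; have {isoZ} := isoZ v lev ltvN.
rewrite /admissible /D /=; have := X_refl v; case: (ty); tauto.
Qed.

(** The three kinds of elements leave enough freedom to make two guesses wrong at
    once, where [v'] appears so late that its relation to [v] is the final one.
    The delicate case is the guess that [v] is not isolated while [v'] is.  Then
    [v] is made isolated, and [v'] large if it lies above [v], small if it lies
    below.  With small and isolated elements only, a [v'] above [v] could only
    become small, which would force [v] to be small too.  In the other cases it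
    suffices to make small everything below the elements that must not be
    isolated. *)
Lemma spoil_two p X v :
  partial_order (rel_of X) -> weakly_stable (rel_of X) -> in_cond X p ->
  len p <= v ->
  exists n, forall v' N ty ty', n <= v' -> v < N -> v' < N ->
    admissible (rel_of X) ty v ->
    exists q, [/\ valid q, extends q p &
      forall Z, in_cond Z q -> [/\ agree N X Z, ~ admissible (rel_of Z) ty v &
        ~ admissible (rel_of Z) ty' v']].
Proof.
move=> poX wsX Xp lev; have [X_refl X_trans X_anti] := poX.
have [l [n nP]] := weakly_stable_label v wsX.
exists (maxn n v.+1) => v' N ty ty' le_v' ltvN ltv'N admv.
have le_nv' := leq_trans (leq_maxl _ _) le_v'.
have lt_vv' := leq_trans (leq_maxr _ _) le_v'.
have neq_vv' : v <> v' by move=> eqv; move: lt_vv'; rewrite eqv ltnn.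
have lev' : len p <= v' by apply: leq_trans lev (ltnW lt_vv').
have le_pN : len p <= N by apply: leq_trans lev (ltnW ltvN).
have isov := isolated_label nP.
have l_ty : l = LI <-> ty by apply: iff_trans admv; apply: iff_sym.
have lab_vv' := nP v' le_nv'.
suff [D [U [[Dd Uu DU_le DU_disj] vP v'P]]] : exists D U : set nat, [/\
    [/\ forall x y, len p <= x -> D y -> rel_of X x y -> D x,
        forall x y, len p <= y -> U x -> rel_of X x y -> U y,
        forall x y, D x -> U y -> rel_of X x y &
        forall x, D x -> U x -> False],
    (D v \/ U v) <-> ty & (D v' \/ U v') <-> ty'].
  have [q [vq qp _ Zq]] := relabel poX Xp le_pN Dd Uu DU_le DU_disj.
  exists q; split=> // Z /Zq[XZ isoZ]; split=> //; rewrite /admissible.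
    have := isoZ v lev ltvN; case: (ty) vP => vP; tauto.
  have := isoZ v' lev' ltv'N; case: (ty') v'P => v'P; tauto.
case: ty {admv} l_ty => l_ty.
  have eql : l = LI by apply/l_ty.
  move: lab_vv'; rewrite eql => -[nvv' nv'v].
  exists [set x | rel_of X x v \/ ty' /\ rel_of X x v'], set0.
  split; first split=> //= x y _.
  - move=> [yv|[? yv']] xy; [left|right; split=> //]; exact: X_trans xy _.
  - by split=> // _; left; left; apply: X_refl.
  - by split=> [[[]|]//|ty'P]; [case|left; right].
have neql : l <> LI by move/l_ty.
case: ty'; last first.
  by exists set0, set0; split=> //; split=> // -[].
case: l neql lab_vv' {nP isov l_ty} => // _ /= v_v'.
  exists set0, [set x | rel_of X v' x]; split; first split=> //= x y _.
  - exact: X_trans.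
  - by split=> // -[//|v'v]; case: neq_vv'; apply: X_anti.
  - by split=> // _; right; apply: X_refl.
exists [set x | rel_of X x v'], set0; split; first split=> //= x y _.
- by move=> yv' xy; apply: X_trans yv'.
- by split=> // -[vv'|//]; case: neq_vv'; apply: X_anti.
- by split=> // _; left; apply: X_refl.
Qed.

(** * A Baire category argument for weakly stable orders *)

(** The weakly stable orders are not a countable union of nowhere dense sets:
    meeting one requirement after the other along a decreasing sequence of
    conditions produces an order avoiding them all, which is weakly stable since
    the conditions in the sequence eventually label every element. *)
Lemma somewhere_dense (T : countType) (B : T -> set nat -> Prop) :
  (forall X, instance WSCAC X -> exists t, B t X) ->
  exists t p, valid p /\
    forall q, valid q -> extends q p -> exists2 X, in_cond X q & B t X.
Proof.
move=> coverB; apply: contrapT => nodense.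
have avoid t p : valid p ->
    exists q, [/\ valid q, extends q p & forall X, in_cond X q -> ~ B t X].
  move=> vp; apply: contrapT => noq; apply: nodense; exists t, p; split=> // q vq qp.
  apply: contrapT => noX; apply: noq; exists q; split=> // X Xq BX.
  by apply: noX; exists X.
have step (pk : cond * nat) : exists q, valid pk.1 -> [/\ valid q, extends q pk.1,
    pk.2 <= len q &
    forall t, pk.2 = pickle t -> forall X, in_cond X q -> ~ B t X].
  case: pk => p k /=; have [vp|] := pselect (valid p); last by exists p.
  have [q [vq qp leq]] := lengthen k vp.
  case Ek: (unpickle k : option T) => [t|]; last first.
    by exists q => _; split=> // t eqk; move: Ek; rewrite eqk pickleK.
  have [r [vr rq rB]] := avoid t q vq.
  exists r => _; split=> //; [exact: extends_trans rq qp| |].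
    by case: rq => _ + _; apply: leq_trans.
  by move=> u eqk; move: Ek; rewrite eqk pickleK => -[->].
have [next nextP] := choice step.
pose p0 : cond := Cond (set_of_rel eq) (fun=> LI) 0.
pose ps := fix ps k := if k is k'.+1 then next (ps k', k') else p0.
have ps_valid k : valid (ps k).
  elim: k => [|k IHk]; last by have [] := nextP (ps k, k) IHk.
  split=> //; rewrite /=.
  have -> : rel_of (set_of_rel eq) = eq.
    by apply/funext => x; apply/funext => y; rewrite rel_of_set_of_rel.
  by split=> [x|x y z -> //|x y ->].
have ps_len k : k <= len (ps k.+1) by have [] := nextP (ps k, k) (ps_valid k).
have ps_ext k j : k <= j -> extends (ps j) (ps k).
  elim: j => [|j IHj]; first by rewrite leqn0 => /eqP->; apply: extends_refl.
  rewrite leq_eqVlt => /predU1P[->|/IHj]; first exact: extends_refl.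
  by apply: extends_trans; have [] := nextP (ps j, j) (ps_valid j).
have len_gt x k : x.+2 <= k -> x < len (ps k).
  move=> lt_xk; apply: leq_trans (ps_len x.+1) _.
  by have [_ + _] := ps_ext _ _ lt_xk.
pose R x y := rel_of (ord (ps (x + y).+2)) x y.
pose Z := set_of_rel R.
have ZE x y j : (x + y).+2 <= j -> rel_of Z x y <-> rel_of (ord (ps j)) x y.
  move=> lej; rewrite rel_of_set_of_rel; have [[+ _] _ _] := ps_ext _ _ lej.
  move=> /(_ x y) eqxy; apply: iff_sym; apply: eqxy; apply: len_gt; lia.
have Zps k : in_cond Z (ps k).
  split=> [x y ltx lty|x y ltx ley]; set j := k + (x + y).+2;
    have [[eq_ord eq_lab] _ _] := ps_ext k j (leq_addr _ _).
    by apply: iff_trans (eq_ord _ _ ltx lty); apply: ZE; rewrite leq_addl.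
  by apply: eq_lab_rel (eq_lab _ _ ltx ley); apply: iff_sym; apply: ZE;
     rewrite /j; lia.
have [|t BZ] := coverB Z.
  split.
    split=> [x|x y z|x y].
    - by apply/ZE; [exact: leqnn|have [[+ _ _] _] := ps_valid (x + x).+2; apply].
    - move: (ps_valid (x + y + z).+2) => [[_ + _] _] => /(_ x y z) tr.
      by move=> /(ZE _ _ (x + y + z).+2) xy /(ZE _ _ (x + y + z).+2) yz;
         apply/(ZE _ _ (x + y + z).+2); [lia|apply: tr; [apply: xy|apply: yz]; lia].
    - move: (ps_valid (x + y).+2) => [[_ _ +] _] => /(_ x y) anti.
      by move=> /(ZE _ _ (x + y).+2) xy /(ZE _ _ (x + y).+2) yx; apply: anti;
         [apply: xy|apply: yx]; lia.
  apply: label_weakly_stable => x; exists (lab (ps x.+2) x), (len (ps x.+2)).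
  by move=> y; case: (Zps x.+2) => _; apply; apply: len_gt.
have [_ _ _ +] := nextP (ps (pickle t), pickle t) (ps_valid _).
by move=> /(_ t erefl Z (Zps (pickle t).+1)).
Qed.

(** * Finite approximations of solutions to a stable order *)

Definition set_of (s : seq bool) : set nat := [set i | nth false s i].

Lemma set_of_size s x : set_of s x -> x < size s.
Proof. by rewrite /set_of /=; case: ltnP => // /(nth_default false)->. Qed.

Lemma agree_prefix s t : prefix s t -> agree (size s) (set_of s) (set_of t).
Proof. by case/prefixP=> u -> i lti; rewrite /set_of /= nth_cat lti. Qed.

Lemma agree_prefix_trans s t A : prefix s t -> agree (size t) (set_of t) A ->
  agree (size s) (set_of s) A.
Proof.
move=> pst tA i lti; apply: iff_trans (agree_prefix pst lti) (tA _ _).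
by apply: leq_trans lti _; apply: size_prefix.
Qed.

(** The gap [m] lets the new element exceed any given threshold. *)
Definition add_elt (s : seq bool) (m : nat) := s ++ rcons (nseq m false) true.

Lemma set_of_add_elt s m x :
  set_of (add_elt s m) x <-> set_of s x \/ x = size s + m.
Proof.
rewrite /set_of /= nth_cat nth_rcons nth_nseq size_nseq if_same.
case: ltnP => lex; first by split=> [|[|eqx]]; [left| |lia].
rewrite (nth_default _ lex); case: ltngtP => [lt|lt|eqm].
- by split=> // -[|eqx] //; lia.
- by split=> // -[|eqx] //; lia.
- by split=> // _; right; lia.
Qed.

Lemma set_of_pad s m : set_of (s ++ nseq m false) = set_of s.
Proof.
apply/funext => x; rewrite /set_of /= nth_cat nth_nseq if_same.
by case: ltnP => // lex; rewrite nth_default.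
Qed.

(** Quantifying over all sets extending [s] makes outputs persist under further
    extension; the neighbourhood makes them persist in orders close to [X]. *)
Definition outputs (d : code) (X : set nat) (s : seq bool) (v : nat) : Prop :=
  nbhd X (fun Y => forall A, agree (size s) (set_of s) A ->
    eval (set_join Y A) d v 1).

Lemma outputs_prefix d X s t v : prefix s t -> outputs d X s v -> outputs d X t v.
Proof.
move=> pst; apply: nbhd_sub => Y Ys A tA; apply: Ys.
exact: agree_prefix_trans tA.
Qed.

Lemma outputs_eval d X s v A : agree (size s) (set_of s) A -> outputs d X s v ->
  eval (set_join X A) d v 1.
Proof. by move=> sA /nbhd_point; apply. Qed.

Lemma eval_outputs d X A v : eval (set_join X A) d v 1 ->
  exists n, forall s, n <= size s -> agree (size s) (set_of s) A ->
    outputs d X s v.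
Proof.
move=> /eval_use[n nP]; exists n => s le_ns sA; exists n => Y XY B sB.
apply: nP; apply: agree_set_join => // i lti.
have lt_is : i < size s by apply: leq_trans le_ns.
by apply: iff_trans (sB _ lt_is); apply: iff_sym; apply: sA.
Qed.

Lemma eventually_forall_lt (P : nat -> Prop) (Q : nat -> nat -> Prop) b :
  (forall x, P x -> exists n, forall y, n <= y -> Q x y) ->
  exists n, forall y, n <= y -> forall x, x < b -> P x -> Q x y.
Proof.
move=> evQ; elim: b => [|b [n nP]]; first by exists 0.
have [Pb|nPb] := pselect (P b); last first.
  exists n => y ley x; rewrite ltnS leq_eqVlt => /predU1P[-> //|].
  exact: nP.
have [m mP] := evQ b Pb; exists (maxn n m) => y ley x.
rewrite ltnS leq_eqVlt => /predU1P[-> _|ltx].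
  by apply: mP; apply: leq_trans ley; rewrite leq_maxr.
by apply: nP => //; apply: leq_trans ley; rewrite leq_maxl.
Qed.

(** In an order all of whose elements are small or isolated, infinite chains
    ([k = false]) consist of small elements and infinite antichains ([k = true])
    of isolated ones. *)
Definition kind_label (k : bool) : label := if k then LI else LS.

Definition of_kind (k : bool) (le : nat -> nat -> Prop) (x : nat) : Prop :=
  exists n, forall y, n <= y -> lab_rel le (kind_label k) x y.

Definition homogeneous (k : bool) (le : nat -> nat -> Prop) (S : set nat) : Prop :=
  forall x y, S x -> S y ->
    if k then x <> y -> incomparable le x y else le x y \/ le y x.

Lemma homogeneous_eq_on k (le le' : nat -> nat -> Prop) (S : set nat) :
  (forall x y, S x -> S y -> (le x y <-> le' x y)) ->
  homogeneous k le S -> homogeneous k le' S.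
Proof.
move=> eq_le hS x y Sx Sy; have := hS x y Sx Sy.
have [] := eq_le x y Sx Sy; have [] := eq_le y x Sy Sx.
by case: k {hS}; rewrite /incomparable; tauto.
Qed.

(** The finite approximations of infinite homogeneous sets. *)
Definition approx (k : bool) (le : nat -> nat -> Prop) (s : seq bool) : Prop :=
  (forall x, set_of s x -> of_kind k le x) /\ homogeneous k le (set_of s).

Lemma approx_extend k le s :
  (forall x, le x x) -> (forall n, exists2 x, n <= x & of_kind k le x) ->
  approx k le s ->
  exists m, approx k le (add_elt s m).
Proof.
move=> le_refl infk [sk s_hom].
have [n nP] := @eventually_forall_lt (set_of s) (lab_rel le (kind_label k)) (size s) sk.
have [x lex kx] := infk (maxn n (size s)).
have eqx : size s + (x - size s) = x by move: lex; rewrite geq_max => /andP[_ /subnKC].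
have sx y : set_of s y -> lab_rel le (kind_label k) y x.
  move=> sy; apply: nP => //; last exact: set_of_size.
  by apply: leq_trans lex; rewrite leq_maxl.
exists (x - size s); split=> [y|y z].
  by rewrite set_of_add_elt eqx => -[/sk|->].
rewrite !set_of_add_elt eqx => -[sy|->] [sz|->].
- exact: s_hom.
- by have := sx _ sy; case: (k) => //=; left.
- by have := sx _ sz; case: (k) => /=; [move=> []; split|right].
- by case: (k) => //; left.
Qed.

(** A requirement [(d, ty, s)] stands for the guess that [d], applied to [X]
    and an infinite homogeneous set extending [s], computes a chain
    ([ty = false]) or antichain ([ty = true]) of [X]. *)
Definition requirement : Type := (code * bool * seq bool)%type.

(** [unspoiled k X le r]: no extension of the approximation in [r] refutes the
    guess, be it by an inadmissible output or by bounding the outputs. *)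
Definition unspoiled (k : bool) (X : set nat) (le : nat -> nat -> Prop)
    (r : requirement) : Prop :=
  let: (d, ty, s) := r in
  approx k le s /\ forall t, prefix s t -> approx k le t ->
    (forall v, outputs d X t v -> admissible (rel_of X) ty v) /\
    (forall n, exists u v, [/\ prefix t u, approx k le u, n <= v & outputs d X u v]).

(** Requirements are spoiled one after the other by finite extensions, each of
    which is followed by the addition of a new element.  A solution to [X] computed
    from the resulting set would contain an inadmissible element or be finite. *)
Lemma generic_homogeneous k X le :
  weakly_stable (rel_of X) -> (forall x, le x x) ->
  (forall n, exists2 x, n <= x & of_kind k le x) ->
  (forall r, ~ unspoiled k X le r) ->
  exists G, [/\ infinite_set G, homogeneous k le G &
    forall Y, solution WSCAC X Y -> ~ turing_le Y (set_join X G)].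
Proof.
move=> wsX le_refl infk spoil.
pose spoiled t (dt : code * bool) :=
  (exists2 v, outputs dt.1 X t v & ~ admissible (rel_of X) dt.2 v) \/
  exists n, forall u v, prefix t u -> approx k le u -> n <= v -> ~ outputs dt.1 X u v.
have spoiled_prefix t u dt : prefix t u -> spoiled t dt -> spoiled u dt.
  move=> ptu [[v tv nadm]|[n nP]]; [left|right].
    by exists v => //; apply: outputs_prefix tv.
  by exists n => w v puw; apply: nP; apply: prefix_trans puw.
have meet s dt : approx k le s ->
    exists t, [/\ prefix s t, approx k le t & spoiled t dt].
  move=> sk; apply: contrapT => not_t; apply: (spoil (dt.1, dt.2, s)).
  split=> // t pst tk.
  split=> [v tv|n]; apply: contrapT => nP; apply: not_t; exists t; split=> //.
    by left; exists v.
  right; exists n => u v ptu uk lev uv; apply: nP.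
  by exists u, v.
have step (sj : seq bool * nat) : exists t, approx k le sj.1 -> [/\ prefix sj.1 t,
    approx k le t, exists2 x, size sj.1 <= x & set_of t x &
    forall dt, sj.2 = pickle dt -> spoiled t dt].
  case: sj => s j /=; have [sk|] := pselect (approx k le s); last by exists s.
  have [t [pst tk spt]] : exists t, [/\ prefix s t, approx k le t &
      forall dt, j = pickle dt -> spoiled t dt].
    case Ej: (unpickle j : option (code * bool)) => [dt|].
      have [t [pst tk spt]] := meet s dt sk.
      by exists t; split=> // dt' eqj; move: Ej; rewrite eqj pickleK => -[->].
    exists s; split=> // [|dt' eqj]; first exact: prefix_refl.
    by move: Ej; rewrite eqj pickleK.
  have [m mk] := approx_extend le_refl infk tk.
  have ptm : prefix t (add_elt t m) by apply: prefix_prefix.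
  exists (add_elt t m) => _; split=> //; first exact: prefix_trans ptm.
    exists (size t + m); last by apply/set_of_add_elt; right.
    by apply: leq_trans (size_prefix pst) _; rewrite leq_addr.
  by move=> dt /spt; apply: spoiled_prefix.
have [next nextP] := choice step.
pose ss := fix ss j := if j is j'.+1 then next (ss j', j') else [::].
have ss_approx j : approx k le (ss j).
  elim: j => [|j IHj]; last by have [] := nextP (ss j, j) IHj.
  by split=> [x|x y]; rewrite /set_of /= nth_nil.
have ss_prefix i j : i <= j -> prefix (ss i) (ss j).
  elim: j => [|j IHj]; first by rewrite leqn0 => /eqP->; apply: prefix_refl.
  rewrite leq_eqVlt => /predU1P[->|/IHj pij]; first exact: prefix_refl.
  by apply: prefix_trans pij _; have [] := nextP (ss j, j) (ss_approx j).
have ss_new j : exists2 x, size (ss j) <= x & set_of (ss j.+1) x.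
  by have [] := nextP (ss j, j) (ss_approx j).
have ss_size j : j <= size (ss j).
  elim: j => // j IHj; have [x lex /set_of_size ltx] := ss_new j.
  exact: leq_ltn_trans (leq_trans IHj lex) ltx.
pose G : set nat := [set i | set_of (ss i.+1) i].
have ssG j : agree (size (ss j)) (set_of (ss j)) G.
  move=> i lti; rewrite /G /=.
  have pj := ss_prefix j (maxn j i.+1) (leq_maxl _ _).
  have pi := ss_prefix i.+1 (maxn j i.+1) (leq_maxr _ _).
  apply: iff_trans (agree_prefix pj lti) _; apply: iff_sym.
  by apply: (agree_prefix pi); apply: ss_size.
exists G; split.
- apply/infinite_setNP => n; have [x lex ssx] := ss_new n; exists x.
    exact: leq_trans (ss_size n) lex.
  by apply/(ssG n.+1) => //; apply: set_of_size.
- move=> x y Gx Gy; have [_] := ss_approx (x + y).+1; apply; apply/ssG => //;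
    by apply: leq_trans (ss_size _); lia.
move=> Y [infY hY] [d dY].
have [ty adm] : exists ty, forall v, Y v -> admissible (rel_of X) ty v.
  case: hY => hY; [exists false|exists true] => v.
    exact: chain_admissible.
  exact: antichain_admissible.
have evY v : eval (set_join X G) d v 1 <-> Y v by apply: computes_eval1.
pose j := pickle (d, ty).
have [_ _ _ /(_ _ erefl) [[v outv]|[n nP]]] := nextP (ss j, j) (ss_approx j).
  by apply; apply/adm/evY; apply: outputs_eval outv; exact: (ssG j.+1).
have [v lev /evY/eval_outputs[m mP]] := (infinite_setNP Y).1 infY n.
apply: (nP (ss (maxn j.+1 m)) v) => //.
- exact: (ss_prefix j.+1 _ (leq_maxl _ _)).
- by apply: mP => //; apply: leq_trans (leq_maxr j.+1 _) (ss_size _).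
Qed.

(** * The separation *)

Definition orient (flip : bool) (le : nat -> nat -> Prop) (x y : nat) : Prop :=
  if flip then le y x else le x y.

Definition small_or_isolated (le : nat -> nat -> Prop) : Prop :=
  forall x, of_kind false le x \/ of_kind true le x.

Lemma isolated_up le x y : Relation_Definitions.transitive nat le ->
  small_or_isolated le -> le x y -> of_kind true le x -> of_kind true le y.
Proof.
move=> le_trans si xy [n nP]; case: (si y) => // -[m mP].
have [] := nP (maxn m n) (leq_maxr _ _); case.
exact: le_trans xy (mP _ (leq_maxl _ _)).
Qed.

Lemma stable_orient R : partial_order R -> stable R ->
  exists flip, [/\ forall x, orient flip R x x,
    Relation_Definitions.transitive nat (orient flip R) &
    small_or_isolated (orient flip R)].
Proof.
move=> [R_refl R_trans _] [st|st]; [exists false|exists true]; split=> //.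
- by move=> x; case: (st x) => [/smallP|/isolatedP]; [left|right].
- by move=> x y z yx zy; apply: R_trans yx.
- move=> x; case: (st x) => [/largeP|/isolatedP [n nP]]; [by left|right].
  by exists n => y /nP[].
Qed.

Lemma homogeneous_solution flip k X S : infinite_set S ->
  homogeneous k (orient flip (rel_of X)) S -> solution SCAC X S.
Proof.
move=> infS hS; split=> //; case: k hS => hS; [right|left] => x y Sx Sy.
  by move=> neq; have := hS x y Sx Sy neq; case: (flip) => -[]; split.
by have := hS x y Sx Sy; case: (flip) => // -[]; [right|left].
Qed.

(** Finite data explaining why no generic solution of a computed stable order
    fails to solve [X]: an unspoiled requirement for each of the two kinds; or
    only one, when all elements from some point on are of its kind. *)
Definition reason : Type :=
  (code * bool * ((requirement * requirement) + (bool * nat * requirement)))%type.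

Definition holds_at (r : reason) (X : set nat) : Prop :=
  let: (c, flip, why) := r in
  instance WSCAC X /\ exists2 X', computes c X X' &
    let le := orient flip (rel_of X') in
    [/\ forall x, le x x, Relation_Definitions.transitive nat le,
        small_or_isolated le &
    match why with
    | inl (r0, r1) => unspoiled false X le r0 /\ unspoiled true X le r1
    | inr (k, b, r) => (forall x, b <= x -> of_kind k le x) /\ unspoiled k X le r
    end].

Lemma reducible_reason : computably_reducible WSCAC SCAC ->
  forall X, instance WSCAC X -> exists r, holds_at r X.
Proof.
move=> red X instX; have [poX wsX] := instX.
have [X' [[c cX'] [poX' stX'] solX']] := red X instX.
have [flip [le_refl le_trans si]] := stable_orient poX' stX'.
set le := orient flip (rel_of X') in le_refl le_trans si.
have req k : (forall n, exists2 x, n <= x & of_kind k le x) ->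
    exists r, unspoiled k X le r.
  move=> infk; apply: contrapT => /forallNP spoil.
  have [G [infG homG noY]] := generic_homogeneous wsX le_refl infk spoil.
  have [Y YX] := solX' G (homogeneous_solution infG homG).
  exact: noY.
have mono k : ~ (forall n, exists2 x, n <= x & of_kind k le x) ->
    exists r, holds_at r X.
  move=> /existsNP[b bP].
  have geb x : b <= x -> of_kind (~~ k) le x.
    move=> lebx; have nk : ~ of_kind k le x by move=> kx; apply: bP; exists x.
    by case: (si x); case: (k) nk.
  have [|r rP] := req (~~ k).
    by move=> n; exists (maxn n b); rewrite ?leq_maxl //; apply/geb/leq_maxr.
  by exists (c, flip, inr (~~ k, b, r)); split=> //; exists X'.
have [inf0|] := pselect (forall n, exists2 x, n <= x & of_kind false le x);
  last exact: mono.
have [inf1|] := pselect (forall n, exists2 x, n <= x & of_kind true le x);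
  last exact: mono.
have [r0 r0P] := req false inf0; have [r1 r1P] := req true inf1.
by exists (c, flip, inl (r0, r1)); split=> //; exists X'.
Qed.

Lemma nbhd_orient c flip X X' b : computes c X X' ->
  nbhd X (fun Y => forall Y', computes c Y Y' -> forall x y, x < b -> y < b ->
    (orient flip (rel_of X') x y <-> orient flip (rel_of Y') x y)).
Proof.
move=> /(@nbhd_computes _ _ _ b); apply: nbhd_sub => Y eqY Y' cY' x y ltx lty.
by case: flip; apply: eqY.
Qed.

(** Only the new elements of [t] have to be checked when an approximation found in
    one order is transferred to another order for which the same requirement
    remains unspoiled. *)
Lemma unspoiled_admissible k Y le d ty s t v :
  unspoiled k Y le (d, ty, s) -> prefix s t -> homogeneous k le (set_of t) ->
  (forall x, size s <= x -> set_of t x -> of_kind k le x) ->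
  outputs d Y t v -> admissible (rel_of Y) ty v.
Proof.
move=> [[sk _] unsp] pst homt newk.
have tk : approx k le t.
  split=> // x tx; case: (ltnP x (size s)) => [lts|]; last by move/newk; apply.
  by apply: sk; apply/(agree_prefix pst lts).
by have [+ _] := unsp t pst tk; apply.
Qed.

Lemma unspoiled_pad k X le d ty s b : unspoiled k X le (d, ty, s) ->
  unspoiled k X le (d, ty, s ++ nseq b false).
Proof.
move=> [sk unsp]; split=> [|t pst]; first by rewrite /approx set_of_pad.
by apply: unsp; apply: prefix_trans pst; apply: prefix_prefix.
Qed.

Lemma single_reason_nowhere_dense c flip k b r p : valid p ->
  ~ (forall q, valid q -> extends q p ->
      exists2 X, in_cond X q & holds_at (c, flip, inr (k, b, r)) X).
Proof.
case: r => [[d ty] s] vp dense.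
have [X Xp [[poX _] [X' cX' [_ _ _ [_ /unspoiled_pad unsp]]]]] :=
  dense p vp (extends_refl vp).
(* The padding makes all new elements exceed [b]. *)
have {unsp} [s1k /(_ _ (prefix_refl _) s1k)[_ /(_ (len p))]] := unsp b.
move=> [t [v [pst [_ homt] lev outv]]].
have [n nP] := nbhd_and outv (nbhd_orient flip (size t) cX').
have [n' n'P] := nbhd_open outv.
have [q [vq qp qP]] := spoil_one ty poX Xp lev (leq_maxr (maxn n n') v.+1).
have [Y /qP[XY nadm] [_ [Y' cY' [_ _ _ [geb /unspoiled_pad unspY]]]]] :=
  dense q vq qp.
have XY1 := agree_leq (leq_maxl _ _) XY.
have [_ eq_le] := nP Y (agree_leq (leq_maxl _ _) XY1).
have outY := n'P Y (agree_leq (leq_maxr _ _) XY1).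
apply: nadm; apply: (unspoiled_admissible (unspY b) pst) outY.
  apply: homogeneous_eq_on homt => x y /set_of_size ltx /set_of_size lty.
  exact: eq_le.
move=> x lex _; apply: geb.
by apply: leq_trans lex; rewrite size_cat size_nseq leq_addl.
Qed.

(** Some finite chain [t] of small elements outputs [v], and some finite antichain
    [t'] of isolated elements, the new ones of which lie above all of [t], outputs
    [v'].  Keep this finite information but make both [v] and [v'] inadmissible.
    As the requirement on chains remains unspoiled, some element of [t] must have
    become isolated; hence so have the elements of [t'] above it.  Then [t'] is
    still an approximation, so that [v'] spoils the requirement on antichains. *)
Lemma double_reason_nowhere_dense c flip r0 r1 p : valid p ->
  ~ (forall q, valid q -> extends q p ->
      exists2 X, in_cond X q & holds_at (c, flip, inl (r0, r1)) X).
Proof.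
case: r0 r1 => [[d ty] s] [[d' ty'] s'] vp dense.
have [X Xp [[poX wsX] [X' cX' [_ _ _ [[sk unsp] /unspoiled_pad unsp']]]]] :=
  dense p vp (extends_refl vp).
set le := orient flip (rel_of X') in sk unsp unsp'.
have [_ /(_ (len p))[t [v [pst tk lev outv]]]] := unsp s (prefix_refl s) sk.
have admv : admissible (rel_of X) ty v by have [+ _] := unsp t pst tk; apply.
have [n nP] := spoil_two poX wsX Xp lev.
have [tsmall homt] := tk.
have [b bP] := @eventually_forall_lt (set_of t) le (size t) tsmall.
(* The padding puts all new elements of [t'] above the whole of [t]. *)
have {unsp'} [s'k /(_ _ (prefix_refl _) s'k)[_ /(_ n)]] := unsp' b.
move=> [t' [v' [pst' [_ homt'] lev' outv']]].
have [m mP] := nbhd_and (nbhd_and (nbhd_open outv) (nbhd_open outv'))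
  (nbhd_orient flip (size t + size t') cX').
have ltl x : x < size t -> x < size t + size t'.
  by move=> /leq_trans; apply; apply: leq_addr.
have ltr x : x < size t' -> x < size t + size t'.
  by move=> /leq_trans; apply; apply: leq_addl.
pose N := maxn m (maxn v v').+1.
have ltvN : v < N by rewrite /N; lia.
have ltv'N : v' < N by rewrite /N; lia.
have [q [vq qp qP]] := nP v' N ty ty' lev' ltvN ltv'N admv.
have [Y /qP[XY nadm nadm'] [_ [Y' cY' [_ leY_trans siY [unspY]]]]] := dense q vq qp.
move=> /unspoiled_pad unspY'.
have [[outY outY'] eq_le] := mP Y (agree_leq (leq_maxl _ _) XY).
set leY := orient flip (rel_of Y') in leY_trans siY unspY unspY'.
have [u tu u_iso] : exists2 u, set_of t u & of_kind true leY u.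
  apply: contrapT => no_iso; apply: nadm.
  apply: (unspoiled_admissible unspY pst) outY.
    apply: homogeneous_eq_on homt => x y /set_of_size ltx /set_of_size lty.
    by apply: eq_le => //; apply: ltl.
  move=> x _ tx; case: (siY x) => // x_iso.
  by case: no_iso; exists x.
apply: nadm'; apply: (unspoiled_admissible (unspY' b) pst') outY'.
  apply: homogeneous_eq_on homt' => x y /set_of_size ltx /set_of_size lty.
  by apply: eq_le => //; apply: ltr.
move=> x lex t'x; apply: isolated_up u_iso => //.
have ltu := set_of_size tu; have ltx := set_of_size t'x.
apply/eq_le => //; [exact: ltl|exact: ltr|apply: bP => //].
by apply: leq_trans lex; rewrite size_cat size_nseq leq_addl.
Qed.

Theorem theorem2p9 : ~ computably_reducible WSCAC SCAC.
Proof.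
move=> /reducible_reason/somewhere_dense.
move=> [[[c flip] [[r0 r1]|[[k b] r]]] [p [vp dense]]].
  exact: double_reason_nowhere_dense dense.
exact: single_reason_nowhere_dense dense.
Qed.
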